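(* Let $\xi,\zeta\in\mathbb{Q}\setminus\{0,1,-1\}$ with $\xi\neq\zeta$ be such that $\xi\zeta$ and $(1-\xi^2)(1-\zeta^2)$ are both squares of rational numbers. Then these give a nearly-perfect cuboid in which the only face diagonal not required to be rational is $d_{ab}$: namely, choosing rationals $\alpha,\beta$ with $\alpha^2=\xi\zeta$, $\beta^2=\xi/\zeta$, and setting $$\frac{d_s}{a}=\frac{1+\alpha^2}{2\alpha},\quad \frac{d_{bc}}{a}=\frac{1-\alpha^2}{2\alpha},\quad \frac{d_{ac}}{a}=\frac{1+\beta^2}{2\beta},\quad \frac{c}{a}=\frac{1-\beta^2}{2\beta},\quad \frac{b}{a}=\sqrt{\frac{(1-\xi^2)(1-\zeta^2)}{4\xi\zeta}},$$ all of these ratios are rational, so that (taking $a$ rational) the edges $a,b,c$, the face diagonals $d_{bc}=\sqrt{b^2+c^2}$, $d_{ac}=\sqrt{a^2+c^2}$ and the space diagonal $d_s=\sqrt{a^2+b^2+c^2}$ are all rational.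
   Context: A cuboid has edges $a,b,c$, face diagonals $d_{ab}=\sqrt{a^2+b^2}$, $d_{bc}=\sqrt{b^2+c^2}$, $d_{ac}=\sqrt{a^2+c^2}$ and space diagonal $d_s=\sqrt{a^2+b^2+c^2}$. A nearly-perfect cuboid (of the type considered) is one in which all of these seven quantities except one face diagonal are rational. *)

(* Defs.v *)
From mathcomp Require Import all_boot all_order all_algebra.
From mathcomp Require Import reals.

Set Implicit Arguments.
Unset Strict Implicit.
Unset Printing Implicit Defensive.

Import Order.TTheory GRing.Theory Num.Theory.
Local Open Scope ring_scope.

Definition rat_square (q : rat) : Prop := exists r : rat, r ^+ 2 = q.

Record cuboid (R : realType) := Cuboid {
  edge_a : R;
  edge_b : R;
  edge_c : R;
  edge_a_gt0 : 0 < edge_a;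
  edge_b_gt0 : 0 < edge_b;
  edge_c_gt0 : 0 < edge_c
}.

Inductive face := Fab | Fbc | Fac.

Definition face_diagonal (R : realType) (K : cuboid R) (f : face) : R :=
  match f with
  | Fab => Num.sqrt (edge_a K ^+ 2 + edge_b K ^+ 2)
  | Fbc => Num.sqrt (edge_b K ^+ 2 + edge_c K ^+ 2)
  | Fac => Num.sqrt (edge_a K ^+ 2 + edge_c K ^+ 2)
  end.

Definition space_diagonal (R : realType) (K : cuboid R) : R :=
  Num.sqrt (edge_a K ^+ 2 + edge_b K ^+ 2 + edge_c K ^+ 2).

(* Nothing is assumed about the diagonal of the exceptional face f: it may be
   rational or irrational. *)
Definition nearly_perfect (R : realType) (f : face) (K : cuboid R) : Prop :=
  [/\ rational (edge_a K), rational (edge_b K), rational (edge_c K),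
      rational (space_diagonal K)
    & forall g : face, g <> f -> rational (face_diagonal K g)].

(* Main.v *)
(* Put every length in units of a: with w^2 = (1 - xi^2)(1 - zeta^2), the ratio
   b/a is |w / (2 alpha)|, and
     (1 - xi zeta)^2 = (1 - xi^2)(1 - zeta^2) + (xi - zeta)^2
   divided by 4 xi zeta says (dbc/a)^2 = (b/a)^2 + (c/a)^2.  The other two
   Pythagorean relations are ((1 + t^2)/(2t))^2 = 1 + ((1 - t^2)/(2t))^2 at
   t = alpha and t = beta. *)
Require Import Defs.
From mathcomp Require Import all_boot all_order all_algebra.
From mathcomp Require Import reals.
From mathcomp Require Import ring.

Set Implicit Arguments.
Unset Strict Implicit.
Unset Printing Implicit Defensive.

Import Order.TTheory GRing.Theory Num.Theory.
Local Open Scope ring_scope.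

Lemma rational_ratr (R : realType) (q : rat) : rational (ratr q : R).
Proof. by exists q. Qed.

Lemma rational_ratrM (R : realType) (q : rat) (x : R) :
  rational x -> rational (ratr q * x).
Proof. by case=> r _ <-; exists (q * r); rewrite ?rmorphM. Qed.

Lemma rational_norm (R : realType) (x : R) : rational x -> rational `|x|.
Proof. by case=> r _ <-; exists `|r|; rewrite ?ratr_norm. Qed.

Lemma ratrM_sqr (R : realType) (q : rat) (x : R) :
  (ratr q * x) ^+ 2 = ratr (q ^+ 2) * x ^+ 2.
Proof. by rewrite exprMn rmorphXn. Qed.

(** Clearing denominators leaves [(1 + t^2)^2 - (1 - t^2)^2 = (2t)^2]. *)
Lemma sqr_half_sum_inv (F : numFieldType) (t : F) : t != 0 ->
  ((1 + t ^+ 2) / (2 * t)) ^+ 2 = 1 + ((1 - t ^+ 2) / (2 * t)) ^+ 2.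
Proof. by move=> t0; field. Qed.

Section Ratios.

Variables (xi zeta alpha beta : rat).
Hypotheses (xi0 : xi != 0) (zeta0 : zeta != 0).
Hypotheses (alpha2 : alpha ^+ 2 = xi * zeta) (beta2 : beta ^+ 2 = xi / zeta).

Lemma alpha_neq0 : alpha != 0.
Proof. by rewrite -sqrf_eq0 alpha2 mulf_neq0. Qed.

Lemma beta_neq0 : beta != 0.
Proof. by rewrite -sqrf_eq0 beta2 mulf_neq0 ?invr_eq0. Qed.

(** Keeps the edge [c] from degenerating: [beta^2 = 1] would mean [xi / zeta = 1]. *)
Lemma c_ratio_neq0 : xi != zeta -> (1 - beta ^+ 2) / (2 * beta) != 0.
Proof.
move=> ne; rewrite mulf_neq0 ?invr_eq0 ?mulf_neq0 ?beta_neq0 //.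
rewrite beta2 subr_eq0; apply: contra_neq ne => e.
by rewrite -[xi](divfK zeta0) -e mul1r.
Qed.

(** Once the squares are expanded, [alpha] and [beta] occur only through [alpha^2] and [beta^2], so
    an identity of rational functions in [xi] and [zeta] remains. *)
Lemma dbc_ratio_sqr :
  ((1 - alpha ^+ 2) / (2 * alpha)) ^+ 2 =
  (1 - xi ^+ 2) * (1 - zeta ^+ 2) / (4 * xi * zeta)
  + ((1 - beta ^+ 2) / (2 * beta)) ^+ 2.
Proof. by rewrite !expr_div_n !exprMn alpha2 beta2; field; rewrite ?xi0 ?zeta0. Qed.

(** Since [4 xi zeta = (2 alpha)^2], the radicand is the square of [w / (2 alpha)]; the absolute
    value is there because the signs of [w] and [alpha] are arbitrary. *)
Lemma b_ratio_rat (R : rcfType) (w : rat) :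
    w ^+ 2 = (1 - xi ^+ 2) * (1 - zeta ^+ 2) ->
  Num.sqrt (ratr ((1 - xi ^+ 2) * (1 - zeta ^+ 2) / (4 * xi * zeta)))
  = ratr `|w / (2 * alpha)| :> R.
Proof.
move=> <-; have -> : w ^+ 2 / (4 * xi * zeta) = (w / (2 * alpha)) ^+ 2.
  by rewrite -mulrA -alpha2; field; exact: alpha_neq0.
by rewrite rmorphXn sqrtr_sqr ratr_norm.
Qed.

End Ratios.

Lemma sub1_sqr_neq0 (x : rat) : x \notin [:: 0; 1; -1] -> 1 - x ^+ 2 != 0.
Proof.
by rewrite !inE !negb_or subr_eq0 [1 == _]eq_sym sqrf_eq1 negb_or => /and3P[_ -> ->].
Qed.

(** [x / y] is [x y] divided by the square [y^2]. For [y = 0] the convention [0^-1 = 0] makes the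
    quotient [0]. *)
Lemma rat_square_div (x y : rat) : rat_square (x * y) -> rat_square (x / y).
Proof.
have [->|y0] := eqVneq y 0; first by move=> _; exists 0; rewrite invr0 mulr0 expr0n.
by case=> r er; exists (r / y); rewrite expr_div_n er; field.
Qed.

(* The displayed formulas give dbc, dac, ds and c with signs (for instance
   dbc < 0 < ds when 1 < alpha), so the lengths are their absolute values. *)
Theorem theorem2 (R : realType) (xi zeta : rat)
    (hxi : xi \notin [:: 0; 1; -1]) (hzeta : zeta \notin [:: 0; 1; -1])
    (hne : xi != zeta)
    (hprod : rat_square (xi * zeta))
    (hcomp : rat_square ((1 - xi ^+ 2) * (1 - zeta ^+ 2))) :
  (exists alpha beta : rat, alpha ^+ 2 = xi * zeta /\ beta ^+ 2 = xi / zeta) /\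
  (forall alpha beta : rat,
     alpha ^+ 2 = xi * zeta -> beta ^+ 2 = xi / zeta ->
   forall a b c dbc dac ds : R,
     0 < a ->
     ds / a = ratr ((1 + alpha ^+ 2) / (2 * alpha)) ->
     dbc / a = ratr ((1 - alpha ^+ 2) / (2 * alpha)) ->
     dac / a = ratr ((1 + beta ^+ 2) / (2 * beta)) ->
     c / a = ratr ((1 - beta ^+ 2) / (2 * beta)) ->
     b / a = Num.sqrt (ratr ((1 - xi ^+ 2) * (1 - zeta ^+ 2)
                             / (4 * xi * zeta))) ->
   [/\ rational (ds / a), rational (dbc / a), rational (dac / a),
       rational (c / a) & rational (b / a)] /\
   exists K : cuboid R,
     [/\ edge_a K = a, edge_b K = b & edge_c K = `|c|] /\
     [/\ space_diagonal K = `|ds|, face_diagonal K Fbc = `|dbc|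
       & face_diagonal K Fac = `|dac|] /\
     (rational a -> nearly_perfect Fab K)).
Proof.
have xi0 : xi != 0 by move: hxi; rewrite inE negb_or => /andP[].
have zeta0 : zeta != 0 by move: hzeta; rewrite inE negb_or => /andP[].
split.
  by case: hprod (rat_square_div hprod) => alpha ? [beta ?]; exists alpha, beta.
move=> alpha beta alpha2 beta2 a b c dbc dac ds a_gt0.
case: hcomp => w w2; rewrite (b_ratio_rat xi0 zeta0 alpha2 _ w2).
have alpha0 := alpha_neq0 xi0 zeta0 alpha2.
have beta0 := beta_neq0 xi0 zeta0 beta2.
have sq_s := sqr_half_sum_inv alpha0.
have sq_ac := sqr_half_sum_inv beta0.
have sq_bc := dbc_ratio_sqr xi0 zeta0 alpha2 beta2.
have c0 := c_ratio_neq0 xi0 zeta0 beta2 hne.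
(* Here [xi] and [zeta] must avoid [1] and [-1]: otherwise the edge [b] would vanish. *)
have w0 : w != 0.
  by rewrite -sqrf_eq0 w2 mulf_neq0 ?sub1_sqr_neq0.
have b_gt0 : 0 < `|w / (2 * alpha)|.
  by rewrite normr_gt0 mulf_neq0 ?invr_eq0 ?mulf_neq0.
have sq_b : `|w / (2 * alpha)| ^+ 2
    = (1 - xi ^+ 2) * (1 - zeta ^+ 2) / (4 * xi * zeta).
  by rewrite real_normK ?num_real // -w2 -mulrA -alpha2; field.
(* From here on the five ratios are opaque rationals, known only through the three Pythagorean
   relations, [sc != 0] and [sb > 0]. *)
rewrite -{}sq_b in sq_bc; move: sq_s sq_ac sq_bc c0 b_gt0.
set s := (1 + _) / (2 * alpha); set sbc := (1 - _) / (2 * alpha).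
set sac := (1 + _) / (2 * beta); set sc := (1 - _) / (2 * beta).
set sb := `|_ / _| => sq_s sq_ac sq_bc c0 sb_gt0 eds edbc edac ec eb.
split; first by rewrite eds edbc edac ec eb; split; exact: rational_ratr.
have a_neq0 : a != 0 by rewrite gt_eqF.
move: eds edbc edac ec eb.
move=> /(canRL (divfK a_neq0)) -> /(canRL (divfK a_neq0)) ->.
move=> /(canRL (divfK a_neq0)) -> /(canRL (divfK a_neq0)) ->.
move=> /(canRL (divfK a_neq0)) ->.
have Kb : 0 < ratr sb * a by rewrite mulr_gt0 ?ltr0q.
have Kc : 0 < `|ratr sc * a| by rewrite normr_gt0 mulf_neq0 ?fmorph_eq0.
(* Two relations chain: [s^2 = 1 + sbc^2 = 1 + sb^2 + sc^2]. *)
have Eds : a ^+ 2 + (ratr sb * a) ^+ 2 + `|ratr sc * a| ^+ 2 = (ratr s * a) ^+ 2.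
  rewrite real_normK ?num_real // !ratrM_sqr sq_s sq_bc !rmorphD rmorph1.
  by rewrite !mulrDl mul1r addrA.
have Ebc : (ratr sb * a) ^+ 2 + `|ratr sc * a| ^+ 2 = (ratr sbc * a) ^+ 2.
  by rewrite real_normK ?num_real // !ratrM_sqr sq_bc rmorphD mulrDl.
have Eac : a ^+ 2 + `|ratr sc * a| ^+ 2 = (ratr sac * a) ^+ 2.
  rewrite real_normK ?num_real // !ratrM_sqr sq_ac rmorphD rmorph1.
  by rewrite mulrDl mul1r.
exists (Cuboid a_gt0 Kb Kc); split=> //.
rewrite /nearly_perfect /space_diagonal /= Eds Ebc Eac !sqrtr_sqr.
split=> // rat_a; split=> //; try exact: rational_ratrM.
- exact/rational_norm/rational_ratrM.
- exact/rational_norm/rational_ratrM.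
(* The face [Fab] is ruled out by [Fab <> Fab]; each of the other two diagonals is the absolute
   value of a rational multiple of [a]. *)
- case=> //= _; rewrite ?Ebc ?Eac sqrtr_sqr; exact/rational_norm/rational_ratrM.
Qed.
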